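(* If a sequent $\alpha\vdash\beta$ is provable in $\mathbf{CDBL}$, then it is valid in the class of all contextual dBas.
   Context: **Double Boolean algebras.** A double Boolean algebra (dBa) is an algebra $\mathbf{D}=(D,\sqcup,\sqcap,\neg,\lrcorner,\top,\bot)$ such that, writing $x\vee y:=\neg(\neg x\sqcap\neg y)$ and $x\wedge y:=\lrcorner(\lrcorner x\sqcup\lrcorner y)$, for all $x,y,z\in D$: (1a) $(x\sqcap x)\sqcap y=x\sqcap y$; (1b) $(x\sqcup x)\sqcup y=x\sqcup y$; (2a) $x\sqcap y=y\sqcap x$; (2b) $x\sqcup y=y\sqcup x$; (3a) $x\sqcap(y\sqcap z)=(x\sqcap y)\sqcap z$; (3b) $x\sqcup(y\sqcup z)=(x\sqcup y)\sqcup z$; (4a) $\neg(x\sqcap x)=\neg x$; (4b) $\lrcorner(x\sqcup x)=\lrcorner x$; (5a) $x\sqcap(x\sqcup y)=x\sqcap x$; (5b) $x\sqcup(x\sqcap y)=x\sqcup x$; (6a) $x\sqcap(y\vee z)=(x\sqcap y)\vee(x\sqcap z)$; (6b) $x\sqcup(y\wedge z)=(x\sqcup y)\wedge(x\sqcup z)$; (7a) $x\sqcap(x\vee y)=x\sqcap x$; (7b) $x\sqcup(x\wedge y)=x\sqcup x$; (8a) $\neg\neg(x\sqcap y)=x\sqcap y$; (8b) $\lrcorner\lrcorner(x\sqcup y)=x\sqcup y$; (9a) $x\sqcap\neg x=\bot$; (9b) $x\sqcup\lrcorner x=\top$; (10a) $\neg\bot=\top\sqcap\top$; (10b) $\lrcorner\top=\bot\sqcup\bot$;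 (11a) $\neg\top=\bot$; (11b) $\lrcorner\bot=\top$; (12) $(x\sqcap x)\sqcup(x\sqcap x)=(x\sqcup x)\sqcap(x\sqcup x)$. The quasi-order is: $x\sqsubseteq y$ iff $x\sqcap y=x\sqcap x$ and $x\sqcup y=y\sqcup y$. $\mathbf{D}$ is contextual if $\sqsubseteq$ is a partial order. **The logic CDBL.** Formulae (set $\mathfrak{F}$) are generated from a countably infinite set $\mathbf{PV}$ of propositional variables and constants $\top,\bot$ by binary connectives $\sqcup,\sqcap$ and unary connectives $\neg,\lrcorner$. Abbreviations: $\alpha\vee\beta:=\neg(\neg\alpha\sqcap\neg\beta)$, $\alpha\wedge\beta:=\lrcorner(\lrcorner\alpha\sqcup\lrcorner\beta)$. A sequent is a pair of formulae, written $\alpha\vdash\beta$; $\alpha\dashv\vdash\beta$ stands for both $\alpha\vdash\beta$ and $\beta\vdash\alpha$. Axiom schemata: (1) $\alpha\vdash\alpha$; (2a) $\alpha\sqcap\beta\vdash\alpha$; (2b) $\alpha\vdash\alpha\sqcup\beta$; (3a) $\alpha\sqcap\beta\vdash\beta$; (3b) $\beta\vdash\alpha\sqcup\beta$; (4a) $\alpha\sqcap\beta\vdash(\alpha\sqcap\beta)\sqcap(\alpha\sqcap\beta)$; (4b) $(\alpha\sqcup\beta)\sqcup(\alpha\sqcup\beta)\vdash\alpha\sqcup\beta$; (5a) $\neg(\alpha\sqcap\alpha)\vdash\neg\alpha$; (5b) $\lrcorner\alpha\vdash\lrcorner(\alpha\sqcup\alpha)$; (6a) $\alpha\sqcap\neg\alpha\vdash\bot$;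 (6b) $\top\vdash\alpha\sqcup\lrcorner\alpha$; (7a) $\neg\neg(\alpha\sqcap\beta)\dashv\vdash\alpha\sqcap\beta$; (7b) $\lrcorner\lrcorner(\alpha\sqcup\beta)\dashv\vdash\alpha\sqcup\beta$; (8a) $\alpha\sqcap\alpha\vdash\alpha\sqcap(\alpha\sqcup\beta)$; (8b) $\alpha\sqcup(\alpha\sqcap\beta)\vdash\alpha\sqcup\alpha$; (9a) $\alpha\sqcap\alpha\vdash\alpha\sqcap(\alpha\vee\beta)$; (9b) $\alpha\sqcup(\alpha\wedge\beta)\vdash\alpha\sqcup\alpha$; (10a) $\alpha\sqcap(\beta\vee\gamma)\dashv\vdash(\alpha\sqcap\beta)\vee(\alpha\sqcap\gamma)$; (10b) $\alpha\sqcup(\beta\wedge\gamma)\dashv\vdash(\alpha\sqcup\beta)\wedge(\alpha\sqcup\gamma)$; (11a) $\bot\vdash\alpha$; (11b) $\alpha\vdash\top$; (12a) $\neg\top\vdash\bot$; (12b) $\top\vdash\lrcorner\bot$; (13a) $\neg\bot\dashv\vdash\top\sqcap\top$; (13b) $\lrcorner\top\dashv\vdash\bot\sqcup\bot$; (14) $(\alpha\sqcup\alpha)\sqcap(\alpha\sqcup\alpha)\dashv\vdash(\alpha\sqcap\alpha)\sqcup(\alpha\sqcap\alpha)$. Rules: from $\alpha\vdash\beta$ infer (R1) $\alpha\sqcap\gamma\vdash\beta\sqcap\gamma$, (R1)$'$ $\gamma\sqcap\alpha\vdash\gamma\sqcap\beta$, (R2) $\alpha\sqcup\gamma\vdash\beta\sqcup\gamma$,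 (R2)$'$ $\gamma\sqcup\alpha\vdash\gamma\sqcup\beta$, (R3) $\neg\beta\vdash\neg\alpha$, (R3)$'$ $\lrcorner\beta\vdash\lrcorner\alpha$; (R4) from $\alpha\vdash\beta$ and $\beta\vdash\gamma$ infer $\alpha\vdash\gamma$; (R5) from $\alpha\sqcap\beta\vdash\alpha\sqcap\alpha$, $\alpha\sqcap\alpha\vdash\alpha\sqcap\beta$, $\alpha\sqcup\beta\vdash\beta\sqcup\beta$ and $\beta\sqcup\beta\vdash\alpha\sqcup\beta$ infer $\alpha\vdash\beta$. A sequent is provable if it is the last member of a finite sequence of sequents, each an axiom or obtained from earlier ones by a rule. **Validity.** A valuation on a contextual dBa $\mathbf{D}$ is a map $v:\mathfrak{F}\to D$ commuting with $\sqcup,\sqcap,\neg,\lrcorner$ and sending $\top,\bot$ to $\top_D,\bot_D$. $v$ satisfies $\alpha\vdash\beta$ iff $v(\alpha)\sqsubseteq v(\beta)$. $\alpha\vdash\beta$ is true in $\mathbf{D}$ iff every valuation on $\mathbf{D}$ satisfies it, and valid in a class iff true in every member. *)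

(* Defs.v *)
From Stdlib Require Import List Relations.
Import ListNotations.

Reserved Notation "x ⊓ y" (at level 40, left associativity).
Reserved Notation "x ⊔ y" (at level 40, left associativity).
Reserved Notation "x ∨ y" (at level 40, left associativity).
Reserved Notation "x ∧ y" (at level 40, left associativity).
Reserved Notation "¬ x" (at level 30, right associativity).
Reserved Notation "⌟ x" (at level 30, right associativity).
Reserved Notation "x ⊑ y" (at level 70, no associativity).
Reserved Notation "α ⊢ β" (at level 70, no associativity).

Record algebra : Type := Algebra {
  carrier :> Type;
  cup : carrier -> carrier -> carrier;
  cap : carrier -> carrier -> carrier;
  neg : carrier -> carrier;
  opp : carrier -> carrier;
  top : carrier;
  bot : carrier
}.

Arguments cup {a} _ _.
Arguments cap {a} _ _.
Arguments neg {a} _.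
Arguments opp {a} _.
Arguments top {a}.
Arguments bot {a}.

Declare Scope dba_scope.
Delimit Scope dba_scope with dba.
Notation "x ⊓ y" := (cap x y) : dba_scope.
Notation "x ⊔ y" := (cup x y) : dba_scope.
Notation "¬ x" := (neg x) : dba_scope.
Notation "⌟ x" := (opp x) : dba_scope.
Notation "⊤" := top : dba_scope.
Notation "⊥" := bot : dba_scope.

Definition vee {D : algebra} (x y : D) : D := (¬ (¬ x ⊓ ¬ y))%dba.
Definition wedge {D : algebra} (x y : D) : D := (⌟ (⌟ x ⊔ ⌟ y))%dba.
Notation "x ∨ y" := (vee x y) : dba_scope.
Notation "x ∧ y" := (wedge x y) : dba_scope.

Section DoubleBoolean.
Local Open Scope dba_scope.

Record is_dBa (D : algebra) : Prop := {
  dba_1a : forall x y : D, (x ⊓ x) ⊓ y = x ⊓ y;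
  dba_1b : forall x y : D, (x ⊔ x) ⊔ y = x ⊔ y;
  dba_2a : forall x y : D, x ⊓ y = y ⊓ x;
  dba_2b : forall x y : D, x ⊔ y = y ⊔ x;
  dba_3a : forall x y z : D, x ⊓ (y ⊓ z) = (x ⊓ y) ⊓ z;
  dba_3b : forall x y z : D, x ⊔ (y ⊔ z) = (x ⊔ y) ⊔ z;
  dba_4a : forall x : D, ¬ (x ⊓ x) = ¬ x;
  dba_4b : forall x : D, ⌟ (x ⊔ x) = ⌟ x;
  dba_5a : forall x y : D, x ⊓ (x ⊔ y) = x ⊓ x;
  dba_5b : forall x y : D, x ⊔ (x ⊓ y) = x ⊔ x;
  dba_6a : forall x y z : D, x ⊓ (y ∨ z) = (x ⊓ y) ∨ (x ⊓ z);
  dba_6b : forall x y z : D, x ⊔ (y ∧ z) = (x ⊔ y) ∧ (x ⊔ z);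
  dba_7a : forall x y : D, x ⊓ (x ∨ y) = x ⊓ x;
  dba_7b : forall x y : D, x ⊔ (x ∧ y) = x ⊔ x;
  dba_8a : forall x y : D, ¬ ¬ (x ⊓ y) = x ⊓ y;
  dba_8b : forall x y : D, ⌟ ⌟ (x ⊔ y) = x ⊔ y;
  dba_9a : forall x : D, x ⊓ ¬ x = ⊥;
  dba_9b : forall x : D, x ⊔ ⌟ x = ⊤;
  dba_10a : ¬ (⊥ : D) = ⊤ ⊓ ⊤;
  dba_10b : ⌟ (⊤ : D) = ⊥ ⊔ ⊥;
  dba_11a : ¬ (⊤ : D) = ⊥;
  dba_11b : ⌟ (⊥ : D) = ⊤;
  dba_12 : forall x : D, (x ⊓ x) ⊔ (x ⊓ x) = (x ⊔ x) ⊓ (x ⊔ x)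
}.

End DoubleBoolean.

Record dBa : Type := DBa {
  dba_algebra :> algebra;
  dba_axioms : is_dBa dba_algebra
}.

Definition sqle {D : algebra} (x y : D) : Prop :=
  (x ⊓ y = x ⊓ x /\ x ⊔ y = y ⊔ y)%dba.
Notation "x ⊑ y" := (sqle x y) : dba_scope.

Definition contextual (D : dBa) : Prop := order D (@sqle D).

Inductive formula : Type :=
| FVar (p : nat)
| FTop
| FBot
| FCup (α β : formula)
| FCap (α β : formula)
| FNeg (α : formula)
| FOpp (α : formula).

Definition FVee (α β : formula) : formula := FNeg (FCap (FNeg α) (FNeg β)).
Definition FWedge (α β : formula) : formula := FOpp (FCup (FOpp α) (FOpp β)).

Record sequent : Type := Sequent { antecedent : formula; succedent : formula }.

Declare Scope cdbl_scope.
Delimit Scope cdbl_scope with cdbl.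
Notation "α ⊓ β" := (FCap α β) : cdbl_scope.
Notation "α ⊔ β" := (FCup α β) : cdbl_scope.
Notation "¬ α" := (FNeg α) : cdbl_scope.
Notation "⌟ α" := (FOpp α) : cdbl_scope.
Notation "⊤" := FTop : cdbl_scope.
Notation "⊥" := FBot : cdbl_scope.
Notation "α ∨ β" := (FVee α β) : cdbl_scope.
Notation "α ∧ β" := (FWedge α β) : cdbl_scope.
Notation "α ⊢ β" := (Sequent α β) : cdbl_scope.

Section CDBL.
Local Open Scope cdbl_scope.

(* A schema written with ⊣⊢ contributes two constructors, the primed one being
   the right-to-left sequent. *)
Inductive axiom : sequent -> Prop :=
| ax_1 α : axiom (α ⊢ α)
| ax_2a α β : axiom (α ⊓ β ⊢ α)
| ax_2b α β : axiom (α ⊢ α ⊔ β)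
| ax_3a α β : axiom (α ⊓ β ⊢ β)
| ax_3b α β : axiom (β ⊢ α ⊔ β)
| ax_4a α β : axiom (α ⊓ β ⊢ (α ⊓ β) ⊓ (α ⊓ β))
| ax_4b α β : axiom ((α ⊔ β) ⊔ (α ⊔ β) ⊢ α ⊔ β)
| ax_5a α : axiom (¬ (α ⊓ α) ⊢ ¬ α)
| ax_5b α : axiom (⌟ α ⊢ ⌟ (α ⊔ α))
| ax_6a α : axiom (α ⊓ ¬ α ⊢ ⊥)
| ax_6b α : axiom (⊤ ⊢ α ⊔ ⌟ α)
| ax_7a α β : axiom (¬ ¬ (α ⊓ β) ⊢ α ⊓ β)
| ax_7a' α β : axiom (α ⊓ β ⊢ ¬ ¬ (α ⊓ β))
| ax_7b α β : axiom (⌟ ⌟ (α ⊔ β) ⊢ α ⊔ β)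
| ax_7b' α β : axiom (α ⊔ β ⊢ ⌟ ⌟ (α ⊔ β))
| ax_8a α β : axiom (α ⊓ α ⊢ α ⊓ (α ⊔ β))
| ax_8b α β : axiom (α ⊔ (α ⊓ β) ⊢ α ⊔ α)
| ax_9a α β : axiom (α ⊓ α ⊢ α ⊓ (α ∨ β))
| ax_9b α β : axiom (α ⊔ (α ∧ β) ⊢ α ⊔ α)
| ax_10a α β γ : axiom (α ⊓ (β ∨ γ) ⊢ (α ⊓ β) ∨ (α ⊓ γ))
| ax_10a' α β γ : axiom ((α ⊓ β) ∨ (α ⊓ γ) ⊢ α ⊓ (β ∨ γ))
| ax_10b α β γ : axiom (α ⊔ (β ∧ γ) ⊢ (α ⊔ β) ∧ (α ⊔ γ))
| ax_10b' α β γ : axiom ((α ⊔ β) ∧ (α ⊔ γ) ⊢ α ⊔ (β ∧ γ))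
| ax_11a α : axiom (⊥ ⊢ α)
| ax_11b α : axiom (α ⊢ ⊤)
| ax_12a : axiom (¬ ⊤ ⊢ ⊥)
| ax_12b : axiom (⊤ ⊢ ⌟ ⊥)
| ax_13a : axiom (¬ ⊥ ⊢ ⊤ ⊓ ⊤)
| ax_13a' : axiom (⊤ ⊓ ⊤ ⊢ ¬ ⊥)
| ax_13b : axiom (⌟ ⊤ ⊢ ⊥ ⊔ ⊥)
| ax_13b' : axiom (⊥ ⊔ ⊥ ⊢ ⌟ ⊤)
| ax_14 α : axiom ((α ⊔ α) ⊓ (α ⊔ α) ⊢ (α ⊓ α) ⊔ (α ⊓ α))
| ax_14' α : axiom ((α ⊓ α) ⊔ (α ⊓ α) ⊢ (α ⊔ α) ⊓ (α ⊔ α)).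

Inductive rule : list sequent -> sequent -> Prop :=
| R1 α β γ : rule [α ⊢ β] (α ⊓ γ ⊢ β ⊓ γ)
| R1' α β γ : rule [α ⊢ β] (γ ⊓ α ⊢ γ ⊓ β)
| R2 α β γ : rule [α ⊢ β] (α ⊔ γ ⊢ β ⊔ γ)
| R2' α β γ : rule [α ⊢ β] (γ ⊔ α ⊢ γ ⊔ β)
| R3 α β : rule [α ⊢ β] (¬ β ⊢ ¬ α)
| R3' α β : rule [α ⊢ β] (⌟ β ⊢ ⌟ α)
| R4 α β γ : rule [α ⊢ β; β ⊢ γ] (α ⊢ γ)
| R5 α β : rule [α ⊓ β ⊢ α ⊓ α; α ⊓ α ⊢ α ⊓ β;
                 α ⊔ β ⊢ β ⊔ β; β ⊔ β ⊢ α ⊔ β] (α ⊢ β).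

End CDBL.

Definition derivation (l : list sequent) : Prop :=
  forall (l1 : list sequent) (s : sequent) (l2 : list sequent),
    l = l1 ++ s :: l2 ->
    axiom s \/ exists ps : list sequent, rule ps s /\ incl ps l1.

Definition provable (s : sequent) : Prop :=
  exists l : list sequent, derivation (l ++ [s]).

Record valuation (D : dBa) : Type := Valuation {
  val :> formula -> D;
  val_cup : forall α β, val (α ⊔ β)%cdbl = (val α ⊔ val β)%dba;
  val_cap : forall α β, val (α ⊓ β)%cdbl = (val α ⊓ val β)%dba;
  val_neg : forall α, val (¬ α)%cdbl = (¬ (val α))%dba;
  val_opp : forall α, val (⌟ α)%cdbl = (⌟ (val α))%dba;
  val_top : val ⊤%cdbl = ⊤%dba;
  val_bot : val ⊥%cdbl = ⊥%dba
}.

Definition satisfies {D : dBa} (v : valuation D) (s : sequent) : Prop :=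
  (v (antecedent s) ⊑ v (succedent s))%dba.

Definition true_in (D : dBa) (s : sequent) : Prop :=
  forall v : valuation D, satisfies v s.

Definition valid_in (K : dBa -> Prop) (s : sequent) : Prop :=
  forall D : dBa, K D -> true_in D s.

(* Main.v *)
Require Import Defs.
From Stdlib Require Import List Relations.
Import ListNotations.

(** Soundness is an induction along a derivation, for a fixed valuation [v] in
    a contextual double Boolean algebra: every axiom is satisfied and every
    rule preserves satisfaction.  Nearly every axiom is an identity of double
    Boolean algebras, and the others say that [x ⊓ y] lies below [x] and [y],
    that [⊥] is least, and the duals.  Monotonicity of [⊓] (lemma [sqle_cap])
    is absorption: if [x ⊑ y] then [x ⊓ z = x ⊓ (y ⊓ z)].  Antitonicity of
    negation ([sqle_neg]) is the Boolean absorption law [y ∨ (y ⊓ x) = y ⊓ y]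
    read through De Morgan.  Contextuality serves the last two rules: (R4) is
    transitivity of [⊑], and in (R5) antisymmetry turns the four premises into
    the two equations that define [x ⊑ y].

    The axioms of double Boolean algebras are stable under exchanging [⊓] with
    [⊔], [¬] with [⌟] and [⊤] with [⊥].  Every law is therefore proved once,
    for [⊓] and [¬], and its mirror image is read off in the [dual] algebra,
    where the order is reversed ([sqle_dual]). *)

Local Open Scope dba_scope.

(** * Duality *)

Definition dual_algebra (D : algebra) : algebra :=
  Algebra D (@cap D) (@cup D) (@opp D) (@neg D) bot top.

Lemma is_dBa_dual (D : algebra) : is_dBa D -> is_dBa (dual_algebra D).
Proof. intros []; constructor; try assumption; cbn; auto. Qed.

Definition dual (D : dBa) : dBa :=
  DBa (dual_algebra D) (is_dBa_dual D (dba_axioms D)).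

Lemma sqle_dual (D : dBa) (x y : D) : @sqle (dual D) y x -> x ⊑ y.
Proof.
  pose proof (dba_axioms D) as H.
  intros [Hcup Hcap]; cbn in Hcup, Hcap; split.
  - now rewrite (dba_2a _ H).
  - now rewrite (dba_2b _ H).
Qed.

Lemma sqle_to_dual (D : dBa) (x y : D) : x ⊑ y -> @sqle (dual D) y x.
Proof. exact (sqle_dual (dual D) y x). Qed.

(** * Equational laws of meet and negation *)

Lemma cap_idem (D : dBa) (x y : D) : (x ⊓ y) ⊓ (x ⊓ y) = x ⊓ y.
Proof.
  pose proof (dba_axioms D) as H.
  rewrite <- (dba_3a _ H x y), (dba_2a _ H x y), (dba_3a _ H y y x),
    (dba_1a _ H y x), (dba_2a _ H y x), (dba_3a _ H).
  apply (dba_1a _ H).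
Qed.

Lemma cap_absorb_l (D : dBa) (x y : D) : (x ⊓ y) ⊓ x = x ⊓ y.
Proof.
  pose proof (dba_axioms D) as H.
  rewrite (dba_2a _ H (x ⊓ y)), (dba_3a _ H).
  apply (dba_1a _ H).
Qed.

Lemma neg_neg (D : dBa) (x : D) : ¬ ¬ x = x ⊓ x.
Proof.
  pose proof (dba_axioms D) as H.
  rewrite <- (dba_4a _ H x). apply (dba_8a _ H).
Qed.

Lemma neg_idem (D : dBa) (x : D) : ¬ x ⊓ ¬ x = ¬ x.
Proof.
  rewrite <- neg_neg, (neg_neg D x). apply (dba_4a _ (dba_axioms D)).
Qed.

(** Expanding [y ⊓ (y ∨ x)] by distributivity gives this join, because negation
    does not distinguish [y] from [y ⊓ y]; axiom (7a) evaluates the same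
    element to [y ⊓ y]. *)
Lemma vee_absorb (D : dBa) (x y : D) : y ∨ (y ⊓ x) = y ⊓ y.
Proof.
  pose proof (dba_axioms D) as H.
  rewrite <- (dba_7a _ H y x).
  rewrite (dba_6a _ H). unfold vee. now rewrite (dba_4a _ H y).
Qed.

(** * The quasi-order *)

Lemma sqle_refl (D : dBa) (x : D) : x ⊑ x.
Proof. now split. Qed.

Lemma sqle_eq (D : dBa) (x y : D) : x = y -> x ⊑ y.
Proof. intros ->. apply sqle_refl. Qed.

Lemma cap_sqle_l (D : dBa) (x y : D) : x ⊓ y ⊑ x.
Proof.
  pose proof (dba_axioms D) as H. split.
  - now rewrite cap_absorb_l, cap_idem.
  - rewrite (dba_2b _ H). apply (dba_5b _ H).
Qed.

Lemma cap_sqle_r (D : dBa) (x y : D) : x ⊓ y ⊑ y.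
Proof. rewrite (dba_2a _ (dba_axioms D)). apply cap_sqle_l. Qed.

Lemma bot_sqle (D : dBa) (x : D) : ⊥ ⊑ x.
Proof. rewrite <- (dba_9a _ (dba_axioms D) x). apply cap_sqle_l. Qed.

Lemma sqle_cap (D : dBa) (x y z : D) : x ⊑ y -> x ⊓ z ⊑ y ⊓ z.
Proof.
  pose proof (dba_axioms D) as H. intros [Hxy _].
  (* [x ⊓ z] is the meet of [x] with [y ⊓ z], hence below [y ⊓ z] *)
  rewrite <- (dba_1a _ H x z), <- Hxy, <- (dba_3a _ H).
  apply cap_sqle_r.
Qed.

Lemma sqle_cap_l (D : dBa) (x y z : D) : x ⊑ y -> z ⊓ x ⊑ z ⊓ y.
Proof.
  rewrite !(dba_2a _ (dba_axioms D) z). apply sqle_cap.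
Qed.

(** If [x ⊑ y] then [¬ x = ¬ (y ⊓ x)], so [¬ y ⊓ ¬ x] is the negation of
    [y ∨ (y ⊓ x) = y ⊓ y], that is, [¬ y]; and a meet lies below its factors. *)
Lemma sqle_neg (D : dBa) (x y : D) : x ⊑ y -> ¬ y ⊑ ¬ x.
Proof.
  pose proof (dba_axioms D) as H. intros [Hxy _].
  assert (E : ¬ y ⊓ ¬ x = ¬ y).
  { rewrite <- (dba_4a _ H x), <- Hxy, (dba_2a _ H x y).
    rewrite <- (dba_8a _ H).
    change (¬ (y ∨ (y ⊓ x)) = ¬ y).
    rewrite vee_absorb. apply (dba_4a _ H). }
  rewrite <- E. apply cap_sqle_r.
Qed.

(** * Soundness *)

Lemma axiom_sound (D : dBa) (v : valuation D) (s : sequent) :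
  axiom s -> satisfies v s.
Proof.
  pose proof (dba_axioms D) as H.
  intros Hs; destruct Hs;
    unfold satisfies, FVee, FWedge; cbn [antecedent succedent];
    repeat rewrite ?(val_cup _ v), ?(val_cap _ v), ?(val_neg _ v),
      ?(val_opp _ v), ?(val_top _ v), ?(val_bot _ v).
  - apply sqle_refl.
  - apply cap_sqle_l.
  - apply sqle_dual, (cap_sqle_l (dual D)).
  - apply cap_sqle_r.
  - apply sqle_dual, (cap_sqle_r (dual D)).
  - apply sqle_eq; symmetry; apply cap_idem.
  - apply sqle_eq, (cap_idem (dual D)).
  - apply sqle_eq, (dba_4a _ H).
  - apply sqle_eq; symmetry; apply (dba_4b _ H).
  - apply sqle_eq, (dba_9a _ H).
  - apply sqle_eq; symmetry; apply (dba_9b _ H).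
  - apply sqle_eq, (dba_8a _ H).
  - apply sqle_eq; symmetry; apply (dba_8a _ H).
  - apply sqle_eq, (dba_8b _ H).
  - apply sqle_eq; symmetry; apply (dba_8b _ H).
  - apply sqle_eq; symmetry; apply (dba_5a _ H).
  - apply sqle_eq, (dba_5b _ H).
  - apply sqle_eq; symmetry; apply (dba_7a _ H).
  - apply sqle_eq, (dba_7b _ H).
  - apply sqle_eq, (dba_6a _ H).
  - apply sqle_eq; symmetry; apply (dba_6a _ H).
  - apply sqle_eq, (dba_6b _ H).
  - apply sqle_eq; symmetry; apply (dba_6b _ H).
  - apply bot_sqle.
  - apply sqle_dual, (bot_sqle (dual D)).
  - apply sqle_eq, (dba_11a _ H).
  - apply sqle_eq; symmetry; apply (dba_11b _ H).
  - apply sqle_eq, (dba_10a _ H).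
  - apply sqle_eq; symmetry; apply (dba_10a _ H).
  - apply sqle_eq, (dba_10b _ H).
  - apply sqle_eq; symmetry; apply (dba_10b _ H).
  - apply sqle_eq; symmetry; apply (dba_12 _ H).
  - apply sqle_eq, (dba_12 _ H).
Qed.

Lemma rule_sound (D : dBa) (v : valuation D) (ps : list sequent) (s : sequent) :
  contextual D -> rule ps s -> Forall (satisfies v) ps -> satisfies v s.
Proof.
  intros [_ Htrans Hanti] Hr Hps.
  destruct Hr; rewrite !Forall_cons_iff in Hps; unfold satisfies in *;
    cbn [antecedent succedent] in *;
    rewrite ?(val_cup _ v), ?(val_cap _ v), ?(val_neg _ v), ?(val_opp _ v)
      in *.
  - apply sqle_cap, Hps.
  - apply sqle_cap_l, Hps.
  - apply sqle_dual, (sqle_cap (dual D)), sqle_to_dual, Hps.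
  - apply sqle_dual, (sqle_cap_l (dual D)), sqle_to_dual, Hps.
  - apply sqle_neg, Hps.
  - apply sqle_dual, (sqle_neg (dual D)), sqle_to_dual, Hps.
  - now apply Htrans with (v β).
  - now split; apply Hanti.
Qed.

Lemma derivation_sound (D : dBa) (v : valuation D) (l : list sequent) :
  contextual D -> derivation l -> Forall (satisfies v) l.
Proof.
  intros HD.
  induction l as [|s l IH] using rev_ind; intros Hl; [constructor|].
  assert (Hprefix : Forall (satisfies v) l).
  { apply IH. intros l1 t l2 ->.
    apply (Hl l1 t (l2 ++ [s])). now rewrite <- app_assoc. }
  apply Forall_app; split; [assumption|]. constructor; [|constructor].
  destruct (Hl l s [] eq_refl) as [Hax | (ps & Hr & Hincl)].
  - now apply axiom_sound.
  - exact (rule_sound D v ps s HD Hr (incl_Forall Hincl Hprefix)).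
Qed.

Theorem theorem26 : forall α β : formula,
  provable (α ⊢ β)%cdbl -> valid_in contextual (α ⊢ β)%cdbl.
Proof.
  intros α β [l Hl] D HD v.
  apply (derivation_sound D v) in Hl; [|exact HD].
  apply Forall_app in Hl as [_ Hlast]. now inversion Hlast.
Qed.
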